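(* Let $n,k\geq 1$ be integers, $N=2n+k$, $G>0$, and let $m_1,\dots,m_N>0$ be masses with $m_{2i}=m_{2i-1}$ for $i=1,\dots,n$ (no restriction on $m_{2n+1},\dots,m_{2n+k}$). For every $\theta\in\mathbb{R}$, the transformation $\Phi_\theta=\widetilde P\circ\widetilde G_\theta\circ\widetilde K:\mathbb{R}^{4N}\to\mathbb{R}^{4N}$ is (by restriction to the phase space $\Omega$) a reversing symmetry of the planar $N$-body system $\dot{\mathbf u}=\mathbf F(\mathbf u)$ on $\Omega$.
   Context: State vectors are $\mathbf u=(\mathbf r_1,\dots,\mathbf r_N,\mathbf v_1,\dots,\mathbf v_N)\in\mathbb{R}^{4N}$ with $\mathbf r_i,\mathbf v_i\in\mathbb{R}^2$ (positions and velocities). The phase space is $\Omega=\Lambda\times\mathbb{R}^{2N}$, where $\Lambda=\{(\mathbf r_1,\dots,\mathbf r_N)\in\mathbb{R}^{2N} : \mathbf r_i\neq\mathbf r_j \text{ for all } i\neq j\}$. The planar $N$-body vector field $\mathbf F:\Omega\to\mathbb{R}^{4N}$ is $$\mathbf F(\mathbf u)=(\mathbf v_1,\dots,\mathbf v_N,\mathbf a_1,\dots,\mathbf a_N),\qquad \mathbf a_i=\sum_{j=1,\,j\neq i}^{N}\frac{G m_j(\mathbf r_j-\mathbf r_i)}{|\mathbf r_j-\mathbf r_i|^3}.$$ Let $G_\theta=\begin{pmatrix}\cos\theta&-\sin\theta\\ \sin\theta&\cos\theta\end{pmatrix}$ and $K=\begin{pmatrix}1&0\\0&-1\end{pmatrix}$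 (here $G_\theta$ is a rotation matrix, not to be confused with the gravitational constant $G$). The maps $\widetilde P,\widetilde G_\theta,\widetilde K:\mathbb{R}^{4N}\to\mathbb{R}^{4N}$ are defined as follows. - $\widetilde P$ swaps the positions $\mathbf r_{2i-1}\leftrightarrow\mathbf r_{2i}$ and the velocities $\mathbf v_{2i-1}\leftrightarrow\mathbf v_{2i}$ for each $i=1,\dots,n$, and leaves $\mathbf r_{2n+l},\mathbf v_{2n+l}$ unchanged for $l=1,\dots,k$. - $\widetilde G_\theta$ replaces every $\mathbf r_i$ by $G_\theta\mathbf r_i$ and every $\mathbf v_i$ by $G_\theta\mathbf v_i$, $i=1,\dots,N$. - $\widetilde K$ replaces every $\mathbf r_i$ by $K\mathbf r_i$ and every $\mathbf v_i$ by $-K\mathbf v_i$, $i=1,\dots,N$. An involution $R:\Omega\to\Omega$ (i.e. $R\circ R=\mathrm{id}$) is a reversing symmetry of $\dot{\mathbf u}=\mathbf F(\mathbf u)$ if $\frac{d}{dt}R(\mathbf u)=-\mathbf F(R(\mathbf u))$ along solutions $\mathbf u(t)$; when $R$ is the restriction of a linear map this means $R(\mathbf F(\mathbf u))=-\mathbf F(R(\mathbf u))$ for all $\mathbf u\in\Omega$. *)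

(* Defs.v *)
From HB Require Import structures.
From mathcomp Require Import all_boot all_order all_algebra.
From mathcomp Require Import all_classical all_reals all_analysis.

Set Implicit Arguments.
Unset Strict Implicit.
Unset Printing Implicit Defensive.
Import Order.TTheory GRing.Theory Num.Theory.
Import numFieldNormedType.Exports.
Local Open Scope classical_set_scope.
Local Open Scope ring_scope.

(* A vector u = (r_1, ..., r_N, v_1, ..., v_N) of R^(4N) is the pair (r, v) of
   2 x N matrices whose columns are the r_i and the v_i. Indices are 0-based:
   r_i is column i - 1 of u.1. The norm carried by this type is a sup norm; it
   only provides the (usual) topology used for time derivatives. *)
Notation state R N := ('M[R]_(2, N) * 'M[R]_(2, N))%type.

(* The norm `|x| of the matrix library is the sup norm, hence this definition. *)
Definition enorm (R : realType) (x : 'cV[R]_2) : R :=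
  Num.sqrt (\sum_(c < 2) x c 0 ^+ 2).

Definition noncollision (R : realType) (N : nat) : set 'M[R]_(2, N) :=
  [set r | forall i j : 'I_N, i != j -> col i r <> col j r].
Arguments noncollision R N : clear implicits.

Definition phase_space (R : realType) (N : nat) : set (state R N) :=
  noncollision R N `*` setT.
Arguments phase_space R N : clear implicits.

Definition acceleration (R : realType) (N : nat) (G : R) (m : 'I_N -> R)
    (r : 'M[R]_(2, N)) (i : 'I_N) : 'cV[R]_2 :=
  \sum_(j < N | j != i)
    (G * m j / enorm (col j r - col i r) ^+ 3) *: (col j r - col i r).

(* Defined on the whole of R^(4N), but meaningful on phase_space only: at a
   collision the division by 0 makes the corresponding terms vanish. *)
Definition Nbody (R : realType) (N : nat) (G : R) (m : 'I_N -> R)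
    (u : state R N) : state R N :=
  (u.2, \matrix_(c < 2, i < N) acceleration G m u.1 i c 0).

Definition mx2 (R : realType) (a b c d : R) : 'M[R]_2 :=
  \matrix_(i < 2, j < 2)
    if i == 0 then (if j == 0 then a else b) else (if j == 0 then c else d).

Definition rotation (R : realType) (theta : R) : 'M[R]_2 :=
  mx2 (cos theta) (- sin theta)
      (sin theta) (cos theta).

Definition reflection (R : realType) : 'M[R]_2 := mx2 1 0 0 (-1).

(* 0-based form of 2i-1 <-> 2i for i = 1, ..., n: each even number below 2n is
   exchanged with its successor. *)
Definition swap_nat (n j : nat) : nat :=
  (if j < 2 * n then if odd j then j.-1 else j.+1 else j)%N.

Lemma swap_nat_subproof (n k : nat) (j : 'I_(2 * n + k)) :
  (swap_nat n j < 2 * n + k)%N.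
Proof.
case: j => j /= ltj; rewrite /swap_nat; case: ifP => // ltj2n.
case: ifPn => [_|/negPf evenj]; first exact: leq_ltn_trans (leq_pred j) ltj.
apply: (@leq_trans (2 * n)); last exact: leq_addr.
rewrite ltn_neqAle ltj2n andbT; apply/eqP => /(congr1 odd).
by rewrite /= evenj mul2n odd_double.
Qed.

Definition swap (n k : nat) (j : 'I_(2 * n + k)) : 'I_(2 * n + k) :=
  Ordinal (swap_nat_subproof j).

Definition Ptilde (R : realType) (n k : nat)
    (u : state R (2 * n + k)) : state R (2 * n + k) :=
  (colsub (@swap n k) u.1, colsub (@swap n k) u.2).

Definition Gtilde (R : realType) (N : nat) (theta : R)
    (u : state R N) : state R N :=
  (rotation theta *m u.1, rotation theta *m u.2).

Definition Ktilde (R : realType) (N : nat) (u : state R N) : state R N :=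
  (reflection R *m u.1, - (reflection R *m u.2)).

Definition Phi (R : realType) (n k : nat) (theta : R) :
    state R (2 * n + k) -> state R (2 * n + k) :=
  @Ptilde R n k \o @Gtilde R (2 * n + k) theta \o @Ktilde R (2 * n + k).
Arguments Phi R n k theta : clear implicits.

Section ReversingSymmetry.
Context {R : realType} {V : normedModType R}.
Implicit Types (Omega : set V) (F S : V -> V) (J : set R) (u : R -> V).

Definition is_solution Omega F J u : Prop :=
  forall t, J t -> Omega (u t) /\ is_derive t (1 : R) u (F (u t)).

Definition reversing_symmetry Omega F S : Prop :=
  [/\ forall x, Omega x -> Omega (S x),
      forall x, Omega x -> S (S x) = x &
      forall J u, open J -> is_interval J -> is_solution Omega F J u ->
        forall t, J t -> is_derive t (1 : R) (S \o u) (- F (S (u t)))].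

End ReversingSymmetry.

(* Main.v *)
Require Import Defs.
From HB Require Import structures.
From mathcomp Require Import all_boot all_order all_algebra.
From mathcomp Require Import all_classical all_reals all_analysis.
From mathcomp Require Import zify ring.

Import Order.TTheory GRing.Theory Num.Theory.
Import numFieldNormedType.Exports.
Local Open Scope classical_set_scope.
Local Open Scope ring_scope.

(** The rotation and the reflection combine into one matrix
    [Q = rotation theta *m reflection], the reflection of the plane across
    the line of slope angle [theta / 2]: a symmetric involution, hence an
    orthogonal matrix.  With [s = swap] the map reads
    [Phi (r, v) = (Q r_s, - Q v_s)], where [r_s] lists the columns of [r] in
    the order given by [s] ([PhiE]).

    Everything follows from this form.  [Phi] is an involution because [Q] and
    [s] are; it maps distinct positions to distinct positions because [Q]
    and [s] are injective.  The accelerations are equivariant under any linear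
    isometry of the plane and any relabelling of the bodies that keeps the masses
    ([acceleration_equivariant]), and [swap] exchanges bodies of equal mass.
    So [Q], together with [s], maps the accelerations of [r] to those of
    [Q r_s], while the minus sign on the velocities gives
    [Phi (F u) = - F (Phi u)].  This algebraic identity becomes the statement
    on solutions because [Phi], being linear and continuous, commutes with
    time derivatives ([is_derive_linear_comp]). *)

(** Neighbourhoods of a matrix are generated by finitely many entrywise
    conditions, so continuity can be tested on entries. *)
Lemma continuous_mx (T K : topologicalType) (m n : nat)
    (f : T -> 'M[K]_(m, n)) :
  (forall i j, continuous (fun x => f x i j)) -> continuous f.
Proof.
move=> cf x A [P Px PA].
have near_P : \forall y \near x, forall i j, P i j (f y i j).
  apply: filter_forall => i; apply: filter_forall => j.
  exact: (cf i j x _ (Px i j)).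
by apply: filterS near_P => y Py; exact: PA.
Qed.

Lemma continuous_mulmx_colsub (R : realType) (N p : nat) (A : 'M[R]_2)
    (s : 'I_p -> 'I_N) : continuous (fun r : 'M[R]_(2, N) => A *m colsub s r).
Proof.
apply: continuous_mx => i j.
have -> : (fun r0 : 'M[R]_(2, N) => (A *m colsub s r0) i j) =
          (fun r0 => \sum_(c < 2) A i c * r0 c (s j)).
  by apply/funext => r0; rewrite mxE; apply: eq_bigr => c _; rewrite mxE.
apply: continuous_big => [|c _ r]; first exact: add_continuous.
by apply: continuousM; [exact: cst_continuous | exact: coord_continuous].
Qed.

(** By linearity the difference quotients of [f \o u] are the images under [f]
    of those of [u]; continuity of [f] then passes to the limit. *)
Lemma is_derive_linear_comp (R : realType) (U V W : normedModType R)
    (f : V -> W) (u : U -> V) (t v : U) (du : V) :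
  linear f -> continuous f -> is_derive t v u du ->
  is_derive t v (f \o u) (f du).
Proof.
move=> lf cf [u_der u_val].
have fB x y : f (x - y) = f x - f y.
  by rewrite -[x - y]addrC -scaleN1r lf scaleN1r addrC.
have fZ a x : f (a *: x) = a *: f x.
  have f0 : f 0 = 0 by rewrite -(subrr 0) fB subrr.
  by rewrite -[a *: x]addr0 lf f0 addr0.
have quot : (fun h : R => h^-1 *: ((f \o u) (h *: v + t) - (f \o u) t)) =
    f \o (fun h : R => h^-1 *: (u (h *: v + t) - u t)).
  by apply/funext => h /=; rewrite fZ fB.
have lim_quot : (fun h : R => h^-1 *: ((f \o u) (h *: v + t) - (f \o u) t))
    @ 0^' --> f du.
  rewrite quot; apply: continuous_cvg; first exact: cf.
  by rewrite -u_val; exact: u_der.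
by split; [apply/cvg_ex; exists (f du) | exact: cvg_lim lim_quot].
Qed.

Lemma col_mulmx_colsub (R : realType) (N p : nat) (A : 'M[R]_2)
    (s : 'I_p -> 'I_N) (r : 'M[R]_(2, N)) (i : 'I_p) :
  col i (A *m colsub s r) = A *m col (s i) r.
Proof. by rewrite mulmx_colsub col_colsub !colE mulmxA. Qed.

(** The Euclidean norm is the square root of [x^T *m x]. *)
Lemma enorm_orthogonal (R : realType) (Q : 'M[R]_2) (x : 'cV[R]_2) :
  Q^T *m Q = 1%:M -> enorm (Q *m x) = enorm x.
Proof.
have gram (y : 'cV[R]_2) : \sum_(c < 2) y c 0 ^+ 2 = (y^T *m y) 0 0.
  by rewrite mxE; apply: eq_bigr => c _; rewrite mxE expr2.
move=> QTQ; rewrite /enorm !gram trmx_mul mulmxA -(mulmxA x^T) QTQ mulmx1.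
by [].
Qed.

(** Each term is a scalar function of a mass and a distance times a difference
    of positions: [Q] keeps the distance and commutes with the rest by
    linearity, and the relabelling permutes the terms of the sum. *)
Lemma acceleration_equivariant (R : realType) (N : nat) (G : R)
    (m : 'I_N -> R) (Q : 'M[R]_2) (s : 'I_N -> 'I_N) (r : 'M[R]_(2, N))
    (i : 'I_N) :
  Q^T *m Q = 1%:M -> bijective s -> (forall j, m (s j) = m j) ->
  acceleration G m (Q *m colsub s r) i = Q *m acceleration G m r (s i).
Proof.
move=> QTQ s_bij ms; rewrite /acceleration mulmx_sumr.
rewrite [RHS](reindex s) /=; last exact: onW_bij.
apply: eq_big => [j|j _]; first by rewrite (inj_eq (bij_inj s_bij)).
by rewrite !col_mulmx_colsub -mulmxBr enorm_orthogonal // ms -scalemxAr.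
Qed.

Lemma swapK (n k : nat) : involutive (@swap n k).
Proof.
move=> [j lt_j]; apply: val_inj; rewrite /= /swap_nat.
case: (ltnP j (2 * n)) => [lt2n|le2n]; last by rewrite ltnNge le2n.
by case: (boolP (odd j)) => odd_j; do 2?case: ifP; lia.
Qed.

Lemma swap_mass (R : realType) (n k : nat) (m : 'I_(2 * n + k) -> R) :
  (forall (i : 'I_n) (a b : 'I_(2 * n + k)),
     a = (2 * i)%N :> nat -> b = (2 * i).+1 :> nat -> m b = m a) ->
  forall j, m (swap j) = m j.
Proof.
move=> hpair j; case: (ltnP j (2 * n)) => [lt_j|ge_j]; last first.
  by congr m; apply: val_inj; rewrite /= /swap_nat ltnNge ge_j.
have lt_half : (j./2 < n)%N by lia.
have [odd_j|even_j] := boolP (odd j).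
  apply/esym/(hpair (Ordinal lt_half)); rewrite /= /swap_nat ?lt_j ?odd_j; lia.
apply: (hpair (Ordinal lt_half)).
  by rewrite /=; lia.
by rewrite /= /swap_nat lt_j (negbTE even_j); lia.
Qed.

Definition tilted_reflection (R : realType) (theta : R) : 'M[R]_2 :=
  rotation theta *m reflection R.

Lemma tilted_reflectionE (R : realType) (theta : R) :
  tilted_reflection R theta =
  mx2 (cos theta) (sin theta) (sin theta) (- cos theta).
Proof.
apply/matrixP => i j; rewrite !mxE !big_ord_recl big_ord0 !mxE /=.
by case: i => -[|[|//]] ?; case: j => -[|[|//]] ? /=; ring.
Qed.

Lemma tilted_reflection_tr (R : realType) (theta : R) :
  (tilted_reflection R theta)^T = tilted_reflection R theta.
Proof.
rewrite tilted_reflectionE; apply/matrixP => i j; rewrite !mxE.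
by case: i => -[|[|//]] ?; case: j => -[|[|//]] ?.
Qed.

Lemma tilted_reflectionK (R : realType) (theta : R) :
  tilted_reflection R theta *m tilted_reflection R theta = 1%:M.
Proof.
rewrite tilted_reflectionE; apply/matrixP => i j.
rewrite !mxE !big_ord_recl big_ord0 !mxE /=; have := cos2Dsin2 theta.
case: i => -[|[|//]] ?; case: j => -[|[|//]] ? /= cs; rewrite -?cs; ring.
Qed.

Lemma PhiE (R : realType) (n k : nat) (theta : R)
    (u : state R (2 * n + k)) :
  Phi R n k theta u =
    (tilted_reflection R theta *m colsub (@swap n k) u.1,
     - (tilted_reflection R theta *m colsub (@swap n k) u.2)).
Proof.
rewrite /Phi /Ptilde /Gtilde /Ktilde /= mulmxN !mulmxA !mulmx_colsub.
congr pair.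
by apply/matrixP => i j; rewrite !mxE.
Qed.

Lemma Phi_linear (R : realType) (n k : nat) (theta : R) :
  linear (Phi R n k theta).
Proof.
move=> a u v; rewrite !PhiE /=.
have colsubD (x y : 'M[R]_(2, 2 * n + k)) :
    colsub (@swap n k) (a *: x + y) =
    a *: colsub (@swap n k) x + colsub (@swap n k) y.
  by apply/matrixP => i j; rewrite !mxE.
apply: injective_projections => /=; rewrite colsubD mulmxDr -scalemxAr //.
by rewrite opprD scalerN.
Qed.

Lemma Phi_continuous (R : realType) (n k : nat) (theta : R) :
  continuous (Phi R n k theta).
Proof.
rewrite (funext (PhiE R n k theta)).
pose Qr := fun r : 'M[R]_(2, 2 * n + k) =>
  tilted_reflection R theta *m colsub (@swap n k) r.
have cQr : continuous Qr by exact: continuous_mulmx_colsub.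
have cfst : continuous (Qr \o fst : state R (2 * n + k) -> _).
  by move=> u; apply: continuous_comp; [exact: cvg_fst | exact: cQr].
have csnd : continuous (- (Qr \o snd) : state R (2 * n + k) -> _).
  move=> u; apply: continuousN.
  by apply: continuous_comp; [exact: cvg_snd | exact: cQr].
move=> u; exact: cvg_pair (cfst u) (csnd u).
Qed.

Lemma PhiK (R : realType) (n k : nat) (theta : R) :
  involutive (Phi R n k theta).
Proof.
have transformK (x : 'M[R]_(2, 2 * n + k)) : tilted_reflection R theta *m
    colsub (@swap n k) (tilted_reflection R theta *m colsub (@swap n k) x) = x.
  rewrite -mulmx_colsub mulmxA tilted_reflectionK mul1mx -colsub_comp.
  rewrite (eq_colsub id) ?mxsub_id //; exact: swapK.
have colsubN (x : 'M[R]_(2, 2 * n + k)) :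
    colsub (@swap n k) (- x) = - colsub (@swap n k) x.
  by apply/matrixP => i j; rewrite !mxE.
by move=> [r v]; rewrite !PhiE /= colsubN mulmxN opprK !transformK.
Qed.

Lemma Phi_phase_space (R : realType) (n k : nat) (theta : R)
    (u : state R (2 * n + k)) :
  phase_space R (2 * n + k) u -> phase_space R (2 * n + k) (Phi R n k theta u).
Proof.
move=> [u_nc _]; split=> // i j neq_ij; rewrite PhiE /= !col_mulmx_colsub.
move=> /(congr1 (mulmx (tilted_reflection R theta))).
rewrite 2!mulmxA tilted_reflectionK !mul1mx; apply: u_nc.
by rewrite (inj_eq (inv_inj (@swapK n k))).
Qed.

Lemma Phi_Nbody (R : realType) (n k : nat) (G : R) (m : 'I_(2 * n + k) -> R)
    (theta : R) (u : state R (2 * n + k)) :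
  (forall j, m (swap j) = m j) ->
  Phi R n k theta (Nbody G m u) = - Nbody G m (Phi R n k theta u).
Proof.
move=> ms; rewrite !PhiE /Nbody /=.
apply: injective_projections; rewrite /= ?opprK //; congr (- _).
apply/matrixP => c i; rewrite [RHS]mxE acceleration_equivariant //; last first.
- exact: inv_bij (@swapK n k).
- by rewrite tilted_reflection_tr tilted_reflectionK.
by rewrite !mxE; apply: eq_bigr => b _; rewrite !mxE.
Qed.

Theorem theorem2 (R : realType) (n k : nat) (G : R) (m : 'I_(2 * n + k) -> R)
    (hn : (1 <= n)%N) (hk : (1 <= k)%N) (hG : 0 < G)
    (hm : forall i : 'I_(2 * n + k), 0 < m i)
    (hpair : forall (i : 'I_n) (a b : 'I_(2 * n + k)),
       a = (2 * i)%N :> nat -> b = (2 * i).+1 :> nat -> m b = m a)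
    (theta : R) :
  [/\ linear (Phi R n k theta),
      reversing_symmetry (phase_space R (2 * n + k)) (Nbody G m)
        (Phi R n k theta) &
      forall u : state R (2 * n + k), phase_space R (2 * n + k) u ->
        Phi R n k theta (Nbody G m u) = - Nbody G m (Phi R n k theta u)].
Proof.
have PhiF (u : state R (2 * n + k)) :
    Phi R n k theta (Nbody G m u) = - Nbody G m (Phi R n k theta u).
  by apply: Phi_Nbody; exact: swap_mass.
split=> //; first exact: Phi_linear.
split=> [u|u _|J u _ _ u_sol t Jt]; [exact: Phi_phase_space|exact: PhiK|].
have [_ u_der] := u_sol t Jt; rewrite -PhiF.
apply: is_derive_linear_comp => //; first exact: Phi_linear.
exact: Phi_continuous.
Qed.
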